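(* Let $(X,T)$ be an invertible t.d.s. acting on a countable space $X$. The following statements are equivalent: (1) $(K(X),T_K)$ is pointwise recurrent; (2) $(K(X),T_K)$ is uniformly rigid; (3) $(K(X),T_K)$ is rigid; (4) $(K(X),T_K)$ is weakly rigid; (5) $(X,T)$ is uniformly rigid; (6) $(X,T)$ is pointwise periodic.
   Context: An invertible t.d.s. is a pair $(X,T)$ with $X$ a compact metric space and $T:X\to X$ a homeomorphism. $K(X)$ is the set of non-empty closed subsets of $X$ with the Hausdorff metric, and $T_K:K(X)\to K(X)$, $T_K(A)=T(A)$; $(K(X),T_K)$ is again an invertible t.d.s. The following notions apply to any invertible t.d.s. $(X,T)$. A point $x$ is recurrent if there is a sequence of integers $n_i\to+\infty$ or a sequence $n_i\to-\infty$ with $T^{n_i}x\to x$. $(X,T)$ is pointwise recurrent if every point is recurrent. $(X,T)$ is weakly rigid if for each $n\in\mathbb{N}=\{1,2,\dots\}$ every point of $X^n$ is recurrent for $T^{(n)}=T\times\cdots\times T$ ($n$ times). $(X,T)$ is rigid (resp. uniformly rigid) if there is a sequence of positive integers $m_i\to\infty$ with $T^{m_i}\to\mathrm{id}$ pointwise (resp. uniformly). $(X,T)$ is pointwise periodic if for each $x\in X$ there is $n\in\mathbb{N}$ with $T^nx=x$. *)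

(* Defs.v *)
From HB Require Import structures.
From mathcomp Require Import all_boot all_order all_algebra.
From mathcomp Require Import all_classical all_reals all_analysis.

Set Implicit Arguments.
Unset Strict Implicit.
Unset Printing Implicit Defensive.

Import Order.TTheory GRing.Theory Num.Theory.
Import numFieldNormedType.Exports.

Local Open Scope classical_set_scope.
Local Open Scope ring_scope.

HB.mixin Record isCompactSpace (X : Type) & Topological X := {
  compact_setT : compact [set: X]
}.

#[short(type="compactMetricType")]
HB.structure Definition CompactMetric (R : numDomainType) :=
  { X of Metric R X & isCompactSpace X }.

Record homeo (X : topologicalType) := Homeo {
  homeo_fun :> X -> X;
  homeo_inv : X -> X;
  homeo_funK : cancel homeo_fun homeo_inv;
  homeo_invK : cancel homeo_inv homeo_fun;
  homeo_continuous : continuous homeo_fun;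
  homeo_inv_continuous : continuous homeo_inv
}.

(* [T^n] for [n] in Z; recall that [Negz k] is the integer [- k.+1]. *)
Definition iterz (X : topologicalType) (T : homeo X) (n : int) : X -> X :=
  match n with
  | Posz k => iter k T
  | Negz k => iter k.+1 (homeo_inv T)
  end.

Section product_homeo.
Context {X : topologicalType}.

Definition prod_fun (n : nat) (f : X -> X) (x : {ptws 'I_n -> X}) :
  {ptws 'I_n -> X} := fun i => f (x i).

Lemma prod_fun_continuous n f : continuous f -> continuous (@prod_fun n f).
Proof.
move=> cf x.
have Fx : Filter (nbhs x) by exact: nbhs_filter.
have FF : Filter (prod_fun f @ x) by exact: fmap_filter.
apply/cvg_sup => i U [V] [[W oW <-] Wfx WU].
have /cf : nbhs (f (x i)) W by exact: open_nbhs_nbhs.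
move=> /(@proj_continuous _ (fun=> X) i x).
by rewrite nbhs_simpl /=; apply: filterS => y Wy; exact: WU.
Qed.

(* [{ptws 'I_n -> X}] is [X^n] with the product topology. *)
Definition prod_homeo (T : homeo X) (n : nat) : homeo {ptws 'I_n -> X}.
Proof.
apply: (@Homeo _ (@prod_fun n T) (@prod_fun n (homeo_inv T))).
- by move=> x; apply/funext => i; rewrite /prod_fun homeo_funK.
- by move=> x; apply/funext => i; rewrite /prod_fun homeo_invK.
- exact/prod_fun_continuous/homeo_continuous.
- exact/prod_fun_continuous/homeo_inv_continuous.
Defined.

End product_homeo.

Definition tends_to_pinfty (n : nat -> int) :=
  forall N : int, \forall i \near \oo, N <= n i.

Definition tends_to_ninfty (n : nat -> int) :=
  forall N : int, \forall i \near \oo, n i <= N.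

Definition recurrent (X : topologicalType) (T : homeo X) (x : X) :=
  exists n : nat -> int, (tends_to_pinfty n \/ tends_to_ninfty n) /\
    iterz T (n i) x @[i --> \oo] --> x.

Definition pointwise_recurrent (X : topologicalType) (T : homeo X) :=
  forall x, recurrent T x.

Definition weakly_rigid (X : topologicalType) (T : homeo X) :=
  forall n, (0 < n)%N -> pointwise_recurrent (prod_homeo T n).

Definition rigid (X : topologicalType) (T : homeo X) :=
  exists m : nat -> nat, [/\ forall i, (0 < m i)%N, m i @[i --> \oo] --> \oo &
    forall x, iter (m i) T x @[i --> \oo] --> x].

Definition uniformly_rigid (X : uniformType) (T : homeo X) :=
  exists m : nat -> nat, [/\ forall i, (0 < m i)%N, m i @[i --> \oo] --> \oo &
    {uniform, iter (m i) T @[i --> \oo] --> (id : X -> X)}].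

Definition pointwise_periodic (X : topologicalType) (T : homeo X) :=
  forall x, exists2 n, (0 < n)%N & iter n T x = x.

Record hyperspace (X : topologicalType) := Hyperspace {
  hset :> set X;
  hset_closed : closed hset;
  hset_neq0 : hset !=set0
}.

Lemma hyperspace_ext (X : topologicalType) (A B : hyperspace X) :
  hset A = hset B -> A = B.
Proof.
case: A B => [A cA A0] [B cB B0] /= AB; case: _ / AB in cB B0 *.
by congr Hyperspace; exact: Prop_irrelevance.
Qed.

HB.instance Definition _ (X : topologicalType) := gen_eqMixin (hyperspace X).
HB.instance Definition _ (X : topologicalType) :=
  gen_choiceMixin (hyperspace X).

Section hausdorff_distance.
Context {R : realType} {X : metricType R}.
Implicit Types A B : set X.

(* [sup] and [inf] are real-valued, hence meaningful only for nonempty bounded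
   sets; this is the case for nonempty [A] and [B] when [X] is compact. *)
Definition dist_to_set (x : X) A : R := inf [set mdist x a | a in A].

Definition excess A B : R := sup [set dist_to_set a B | a in A].

Definition hausdorff_dist A B : R := Num.max (excess A B) (excess B A).

End hausdorff_distance.

Section hyperspace_metric.
Context {R : realType} {X : compactMetricType R}.
Implicit Types A B C : hyperspace X.

Lemma mdist_bounded : exists M : R, forall x y : X, mdist x y <= M.
Proof.
have [[x0 _]|X0] := pselect ([set: X] !=set0); last first.
  by exists 0 => x; exfalso; apply: X0; exists x.
have /compact_near_coveringP := @compact_setT R X.
move=> /(_ R (+oo) (fun M x => mdist x0 x <= M) _) [x _|M0 [_ HM]].
  exists (ball x 1, [set M | mdist x0 x + 1 < M]) => /=.
    by split; [exact: nbhsx_ballx|exists (mdist x0 x + 1); split => //;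
      exact: num_real].
  move=> [y M] /= []; rewrite ballEmdist/= => xy1 xM.
  rewrite (le_trans (metric_triangle x0 x y))// ltW//.
  by rewrite (lt_trans _ xM)// ltrD2l.
have h x : mdist x0 x <= M0 + 1 by apply: HM => //; rewrite ltrDl.
exists (M0 + 1 + (M0 + 1)) => x y.
rewrite (le_trans (metric_triangle x x0 y))// lerD//.
by rewrite metric_sym.
Qed.

Lemma dist_to_set_lb (x : X) (A : set X) :
  has_lbound [set mdist x a | a in A].
Proof. by exists 0 => _ [a _ <-]; exact: mdist_ge0. Qed.

Lemma dist_to_set_le (x a : X) (A : set X) :
  A a -> dist_to_set x A <= mdist x a.
Proof. by move=> Aa; apply: ge_inf; [exact: dist_to_set_lb|exists a]. Qed.

Lemma dist_to_set_lt (x : X) A (e : R) :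
  dist_to_set x A < e -> exists2 a, hset A a & mdist x a < e.
Proof.
move=> xAe; have [a0 Aa0] := hset_neq0 A.
have [||_ [a Aa <-]] := @inf_adherent R [set mdist x a | a in A]
  (e - dist_to_set x A).
- by rewrite subr_gt0.
- by split; [exists (mdist x a0), a0|exact: dist_to_set_lb].
- by rewrite addrC subrK; exists a.
Qed.

Lemma excess_ub A B : has_ubound [set dist_to_set a B | a in A].
Proof.
have [M hM] := mdist_bounded; have [b Bb] := hset_neq0 B.
by exists M => _ [a _ <-]; apply: (le_trans (dist_to_set_le a Bb)).
Qed.

Lemma excess_lt A B (e : R) : excess A B < e ->
  forall a, hset A a -> exists2 b, hset B b & mdist a b < e.
Proof.
move=> ABe a Aa; apply: dist_to_set_lt; apply: le_lt_trans ABe.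
by apply: ub_le_sup; [exact: excess_ub|exists a].
Qed.

Lemma excess_le A B (e : R) :
  (forall a, hset A a -> exists2 b, hset B b & mdist a b <= e) -> excess A B <= e.
Proof.
move=> ABe; have [a0 Aa0] := hset_neq0 A.
apply: ge_sup; first by exists (dist_to_set a0 B), a0.
move=> _ [a Aa <-]; have [b Bb abe] := ABe _ Aa.
exact: le_trans (dist_to_set_le _ Bb) abe.
Qed.

Lemma hausdorff_dist_lt A B (e : R) : hausdorff_dist A B < e ->
  (forall a, hset A a -> exists2 b, hset B b & mdist a b < e) /\
  (forall b, hset B b -> exists2 a, hset A a & mdist b a < e).
Proof. by rewrite gt_max => /andP[/excess_lt ? /excess_lt ?]. Qed.

Lemma hausdorff_dist_le A B (e : R) :
  (forall a, hset A a -> exists2 b, hset B b & mdist a b <= e) ->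
  (forall b, hset B b -> exists2 a, hset A a & mdist b a <= e) ->
  hausdorff_dist A B <= e.
Proof. by move=> AB BA; rewrite ge_max !excess_le. Qed.

Lemma excess_ge0 A B : 0 <= excess A B.
Proof.
rewrite leNgt; apply/negP => AB0; have [a Aa] := hset_neq0 A.
by have [b _] := excess_lt AB0 Aa; rewrite ltNge mdist_ge0.
Qed.

Lemma hausdorff_dist_ge0 A B : 0 <= hausdorff_dist A B.
Proof. by rewrite le_max excess_ge0. Qed.

Lemma hausdorff_distxx A : hausdorff_dist A A = 0.
Proof.
apply/le_anti; rewrite hausdorff_dist_ge0 andbT.
by apply: hausdorff_dist_le => a Aa; exists a; rewrite // mdistxx.
Qed.

Lemma hausdorff_dist_sym A B : hausdorff_dist A B = hausdorff_dist B A.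
Proof. by rewrite /hausdorff_dist maxC. Qed.

Lemma hausdorff_dist_triangle B A C :
  hausdorff_dist A C <= hausdorff_dist A B + hausdorff_dist B C.
Proof.
apply/ler_addgt0Pl => e e0; rewrite addrC.
have e20 : 0 < e / 2 by rewrite divr_gt0.
have lte (D E : hyperspace X) : hausdorff_dist D E < hausdorff_dist D E + e / 2.
  by rewrite ltrDl.
have [AB BA] := hausdorff_dist_lt (lte A B).
have [BC CB] := hausdorff_dist_lt (lte B C).
have sumE : hausdorff_dist A B + hausdorff_dist B C + e =
  (hausdorff_dist A B + e / 2) + (hausdorff_dist B C + e / 2).
  by rewrite addrACA -splitr.
apply: hausdorff_dist_le; rewrite sumE.
- move=> a /AB [b /BC [c Cc bc] ab]; exists c => //.
  by rewrite (le_trans (metric_triangle a b c))// ltW// ltrD.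
- move=> c /CB [b /BA [a Aa ba] cb]; exists a => //.
  by rewrite (le_trans (metric_triangle c b a))// addrC ltW// ltrD.
Qed.

Lemma hausdorff_dist_positivity A B : hausdorff_dist A B = 0 -> A = B.
Proof.
have sub (C D : hyperspace X) : hausdorff_dist C D = 0 -> hset C `<=` hset D.
  move=> CD0 c Cc; apply: (@hset_closed _ D) => U /nbhs_ballP[e /= e0 ceU].
  have [+ _] := @hausdorff_dist_lt C D e ltac:(by rewrite CD0).
  move=> /(_ _ Cc)[d Dd cd]; exists d; split => //.
  by apply: ceU; rewrite ballEmdist.
move=> AB0; apply: hyperspace_ext; apply/seteqP; split; first exact: sub.
by apply: sub; rewrite hausdorff_dist_sym.
Qed.

HB.instance Definition _ := isMetric.Build R (hyperspace X) hausdorff_distxx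
  hausdorff_dist_positivity hausdorff_dist_sym hausdorff_dist_triangle.

Lemma hyperspace_mdistE A B : mdist A B = hausdorff_dist A B.
Proof. by []. Qed.

Let ultra_limit (F : set_system (hyperspace X)) (Q : hyperspace X -> X -> Prop) :
  UltraFilter F -> F [set A | exists x, Q A x] ->
  exists x, forall e : R, 0 < e -> F [set A | exists2 y, Q A y & mdist x y < e].
Proof.
move=> UF FQ; have FF : ProperFilter F by exact: ultra_proper.
have [|g gQ] := @choice _ _ (fun A x => (exists x, Q A x) -> Q A x).
  move=> A.
  have [[x Qx]|nQ] := pselect (exists x, Q A x); first by exists x.
  by have [a _] := hset_neq0 A; exists a.
have [x [_ clx]] := @compact_setT R X (g @ F) _ filterT.
exists x => e e0.
have [|Fn] := in_ultra_setVsetC [set A | mdist x (g A) < e] UF.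
  by move=> Fe; apply: filterS2 FQ Fe => A /gQ QA xA; exists (g A).
have [|y [/= nxy]] := clx [set y | ~ mdist x y < e] (ball x e) _
    (nbhsx_ballx _ _ e0); first exact: Fn.
by rewrite ballEmdist.
Qed.

Lemma hyperspace_compact : compact [set: hyperspace X].
Proof.
rewrite compact_ultra => F UF _; have FF : ProperFilter F by exact: ultra_proper.
pose L := [set x : X | forall e : R, 0 < e ->
  F [set A | exists2 y, hset A y & mdist x y < e]].
have half (e : R) : 0 < e -> 0 < e / 2 by move=> ?; rewrite divr_gt0.
have clL : closed L.
  move=> x clx e e0.
  have [y [Ly]] := clx _ (nbhsx_ballx _ _ (half _ e0)).
  rewrite ballEmdist/= => xy; apply: filterS (Ly _ (half _ e0)) => A [z Az yz].
  exists z => //; rewrite (le_lt_trans (metric_triangle x y z))//.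
  by rewrite (splitr e) ltrD.
have L0 : L !=set0.
  have [|x Lx] := @ultra_limit F (fun A x => hset A x) UF; last by exists x.
  by apply: filterE => A; have [a Aa] := hset_neq0 A; exists a.
pose L' := Hyperspace clL L0; exists L'; split => //.
apply/metricType_numDomainType.cvgrPdist_le => e e0.
have half' := half _ e0.
have near1 : F [set A | forall x, L x -> exists2 y, hset A y & mdist x y <= e].
  have [//|Fn] := in_ultra_setVsetC [set A | forall x, L x ->
    exists2 y, hset A y & mdist x y <= e] UF.
  have [|x Hx] := @ultra_limit F (fun A x => L x /\
      forall y, hset A y -> e < mdist x y) UF.
    apply: filterS Fn => A /= /existsNP[x /not_implyP[Lx nx]]; exists x.
    split => // y Ay; rewrite ltNge; apply/negP => xy; apply: nx.
    by exists y.
  have Lx : L x.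
    apply: (clL) => U /nbhs_ballP[d /= d0 xdU].
    have /filter_ex[A [z [Lz _] xz]] := Hx _ d0.
    by exists z; split => //; apply: xdU; rewrite ballEmdist.
  have [A [/= [z [_ nz] xz] [y Ay xy]]] :=
    @filter_ex _ F FF _ (filterI (Hx _ half') (Lx _ half')).
  have := nz _ Ay; rewrite ltNge => /negP; case.
  rewrite (le_trans (metric_triangle z x y))// (splitr e) lerD ?ltW//.
  by rewrite metric_sym.
have near2 : F [set A | forall y, hset A y -> exists2 x, L x & mdist y x <= e].
  have [//|Fn] := in_ultra_setVsetC [set A | forall y, hset A y ->
    exists2 x, L x & mdist y x <= e] UF.
  have [|x Hx] := @ultra_limit F (fun A y => hset A y /\
      forall x, L x -> e < mdist y x) UF.
    apply: filterS Fn => A /= /existsNP[x /not_implyP[Ax nx]]; exists x.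
    split => // y Ly; rewrite ltNge; apply/negP => xy; apply: nx.
    by exists y.
  have Lx : L x.
    by move=> d d0; apply: filterS (Hx _ d0) => A [y [Ay _] xy]; exists y.
  have /filter_ex[A [y [_ /(_ _ Lx) ey] xy]] := Hx _ e0.
  by have := lt_trans ey; rewrite metric_sym => /(_ _ xy); rewrite ltxx.
apply: filterS2 near1 near2 => A nA1 nA2.
by rewrite hyperspace_mdistE; exact: hausdorff_dist_le.
Qed.

HB.instance Definition _ :=
  isCompactSpace.Build (hyperspace X) hyperspace_compact.

End hyperspace_metric.

Section hyperspace_homeo.
Context {R : realType} {X : compactMetricType R}.

Lemma homeo_image_closed (f g : X -> X) (A : set X) :
  cancel g f -> cancel f g -> continuous g -> closed A -> closed (f @` A).
Proof.
move=> gK fK cg cA; rewrite (_ : f @` A = g @^-1` A).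
  by apply: preimage_closed.
apply/seteqP; split=> [_ [a Aa <-] /=|x /= Ax]; first by rewrite fK.
by exists (g x).
Qed.

Definition hyper_fun (T : homeo X) (A : hyperspace X) : hyperspace X :=
  Hyperspace
    (homeo_image_closed (@homeo_invK _ T) (@homeo_funK _ T)
       (@homeo_inv_continuous _ T) (@hset_closed _ A))
    (image_nonempty T (@hset_neq0 _ A)).

Lemma hyper_fun_continuous (T : homeo X) : continuous (hyper_fun T).
Proof.
move=> A; have FA : Filter (nbhs A) by exact: nbhs_filter.
apply/metricType_numDomainType.cvgrPdist_le => e e0.
have : \forall d \near (0:R)^'+, [set: X] `<=`
    [set x | forall y, mdist x y < d -> mdist (T x) (T y) <= e].
  have /compact_near_coveringP := @compact_setT R X; apply => x _.
  have e20 : 0 < e / 2 by rewrite divr_gt0.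
  have := @homeo_continuous _ T x _ (nbhsx_ballx _ _ e20).
  move=> /nbhs_ballP[r /= r0 xr].
  have r20 : 0 < r / 2 by rewrite divr_gt0.
  exists (ball x (r / 2), [set d | d < r / 2]) => /=.
    by split; [exact: nbhsx_ballx|exact: nbhs_right_lt].
  move=> [y d] /= []; rewrite ballEmdist/= => xy dr z yz.
  have := xr y; rewrite !ballEmdist/= => /(_ _)/ltW xy'.
  have := xr z; rewrite !ballEmdist/= => /(_ _)/ltW xz'.
  rewrite (le_trans (metric_triangle _ (T x) _))// (splitr e) lerD//.
    rewrite metric_sym; apply: xy'.
    by rewrite (lt_trans xy)// ltr_pdivrMr// ltr_pMr// ltr1n.
  apply: xz'; rewrite (le_lt_trans (metric_triangle _ y _))// (splitr r).
  by rewrite ltrD// (lt_trans yz).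
move=> dT.
have [d [/= d0 Td']] := filter_ex (filterI (nbhs_right_gt (0 : R)) dT).
have Td x y : mdist x y < d -> mdist (T x) (T y) <= e by exact: Td'.
have : nbhs A (ball A d) by exact: nbhsx_ballx.
apply: filterS => B; rewrite ballEmdist/= hyperspace_mdistE.
move=> /hausdorff_dist_lt[AB BA]; rewrite hyperspace_mdistE.
apply: hausdorff_dist_le => _ [x xA <-] /=.
- by have [b Bb ab] := AB _ xA; exists (T b); [exists b|exact: Td].
- by have [b Bb ab] := BA _ xA; exists (T b); [exists b|exact: Td].
Qed.

Definition homeo_sym (T : homeo X) : homeo X :=
  Homeo (@homeo_invK _ T) (@homeo_funK _ T)
    (@homeo_inv_continuous _ T) (@homeo_continuous _ T).

Definition hyper_homeo (T : homeo X) : homeo (hyperspace X).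
Proof.
apply: (@Homeo _ (hyper_fun T) (hyper_fun (homeo_sym T))).
- move=> A; apply: hyperspace_ext => /=; rewrite image_comp.
  by rewrite (_ : _ \o _ = id) ?image_id//; apply/funext => x; exact: homeo_funK.
- move=> A; apply: hyperspace_ext => /=; rewrite image_comp.
  by rewrite (_ : _ \o _ = id) ?image_id//; apply/funext => x; exact: homeo_invK.
- exact: hyper_fun_continuous.
- exact: hyper_fun_continuous.
Defined.

End hyperspace_homeo.

(* Main.v *)
(* A recurrent point of a countable compact space is periodic: its orbit has an
   isolated point, since otherwise nested balls avoiding the points of an
   enumeration one by one would have a common point.  Conversely suppose that
   every point is periodic, and choose arbitrarily small radii [r] that are not
   among the countably many values of the metric, so that [d(x, y) < r] defines
   a clopen subset of [X * X].  By periodicity a pair at distance more than [r]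
   was so already at an earlier time, at most [N] steps before with [N] uniform
   by compactness; hence two points whose orbits stay [r]-close up to time [N]
   stay so forever.  This equicontinuity and compactness give [T^(n!) -> id]
   uniformly, on [X] and therefore on the hyperspace. *)
Require Import Defs.
From mathcomp Require Import all_boot all_order all_algebra.
From mathcomp Require Import all_classical all_reals all_analysis.
From mathcomp Require Import lra.

Set Implicit Arguments.
Unset Strict Implicit.
Unset Printing Implicit Defensive.

Import Order.TTheory GRing.Theory Num.Theory.
Import numFieldNormedType.Exports.

Local Open Scope classical_set_scope.
Local Open Scope ring_scope.

(** * Distances, uniform convergence and isolated points *)

Section metric_lemmas.
Context {R : realType} {X : metricType R}.

Lemma continuous_mdist (Y : topologicalType) (f g : Y -> X) :
  continuous f -> continuous g -> continuous (fun y => mdist (f y) (g y) : R).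
Proof.
move=> cf cg y; have Fy : Filter (nbhs y) by exact: nbhs_filter.
apply/cvgrPdist_lt => e e0.
have e20 : 0 < e / 2 by rewrite divr_gt0.
have cf_near : \forall z \near y, mdist (f y) (f z) < e / 2.
  exact: metricType_numDomainType.cvgr_dist_lt (cf y) _ e20.
have cg_near : \forall z \near y, mdist (g y) (g z) < e / 2.
  exact: metricType_numDomainType.cvgr_dist_lt (cg y) _ e20.
apply: filterS2 cf_near cg_near => z /= fz gz.
rewrite (splitr e) ltr_norml opprD; apply/andP; split.
  rewrite -subr_gt0.
  have := metric_triangle (f z) (f y) (g z).
  have := metric_triangle (f y) (g y) (g z).
  rewrite (metric_sym (f z) (f y)); lra.
have := metric_triangle (f y) (f z) (g y).
have := metric_triangle (f z) (g z) (g y).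
rewrite (metric_sym (g z) (g y)); lra.
Qed.

Lemma uniform_cvg_idP (f : nat -> X -> X) :
  {uniform, f i @[i --> \oo] --> (id : X -> X)} <->
  forall e : R, 0 < e -> \forall i \near \oo, forall x, mdist x (f i x) < e.
Proof.
split=> [fid e e0|fid].
  have /fid : nbhs (id : {uniform X -> X})
      [set h | forall x, mdist x (h x) < e].
    apply/uniform_nbhs; exists [set xy | ball xy.1 e xy.2]; split.
      exact: (entourage_ball X (PosNum e0)).
    by move=> h /= eh x; have := eh x I; rewrite ballEmdist.
  by [].
move=> P /uniform_nbhs[E [+ EP]]; rewrite -entourage_ballE => -[e /= e0 eE].
apply: filterS (fid _ e0) => i fie; apply: EP => x _; apply: eE => /=.
by rewrite ballEmdist; exact: fie.
Qed.

(** The values of the metric form a countable, hence Lebesgue-null, set of reals, which cannot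
    contain an interval of positive length. *)
Lemma countable_avoid_dist (e : R) : countable [set: X] -> 0 < e ->
  exists r : R, [/\ 0 < r, r < e & forall x y : X, mdist x y != r].
Proof.
move=> cX e0.
pose D := [set (mdist p.1 p.2 : R) | p in [set: X] `*` [set: X]].
have cD : countable D.
  by apply: sub_countable (card_image_le _ _) _; exact: countableX.
apply: contrapT => noR.
have sub : `]0, e[%classic `<=` D.
  move=> r /=; rewrite in_itv/= => /andP[r0 re]; apply: contrapT => Dr.
  apply: noR; exists r; split=> // x y; apply/eqP => xyr; apply: Dr.
  by exists (x, y).
have := countable_lebesgue_measure0 (sub_countable (subset_card_le sub) cD).
by rewrite lebesgue_measure_itv/= lte_fin e0 sube0 => /eqP; rewrite eqe gt_eqF.
Qed.

End metric_lemmas.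

(** A Baire-type argument. Only the centres of the nested closed balls lie in [A]; their common
    point is sought in the compact space [X], so [A] may be any orbit, closed or not. *)
Lemma countable_compact_isolated (R : realType) (X : compactMetricType R)
    (A : set X) : countable [set: X] -> A !=set0 ->
  exists z, A z /\ exists2 e : R, 0 < e &
    forall w, A w -> mdist z w < e -> w = z.
Proof.
move=> /countable_injP[f finj] [a Aa]; apply: contrapT => noiso.
have perf z (e : R) : A z -> 0 < e ->
    exists w, [/\ A w, mdist z w < e & w != z].
  move=> Az e0; apply: contrapT => now; apply: noiso; exists z; split => //.
  exists e => // w Aw zw; apply: contrapT => /eqP wz.
  by apply: now; exists w.
(* [p] carries a number [n] and a ball given by centre and radius; [q] is a ball inside it without
   the point numbered [n]. The pair [(z, r)] is a default when the invariant on [p] fails, and the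
   ball is kept when no point has number [n]. *)
have shrink (p : nat * (X * R)) : exists q : X * R,
    A p.2.1 /\ 0 < p.2.2 -> [/\ A q.1, 0 < q.2 & forall x, mdist q.1 x <= q.2 ->
      mdist p.2.1 x <= p.2.2 /\ f x <> p.1].
  case: p => n [z r] /=.
  have [[Az r0]|] := pselect (A z /\ 0 < r); last by exists (z, r).
  have [[y fy]|noy] := pselect (exists y, f y = n); last first.
    exists (z, r); split => //= x zx; split => // fx; apply: noy.
    by exists x.
  (* The new centre must differ from [y]: [z] will do unless it is [y] itself, and then
     non-isolation supplies another point of [A]. *)
  have [w [Aw zw wy]] : exists w, [/\ A w, mdist z w < r & w != y].
    have [zy|zy] := eqVneq z y; last by exists z; rewrite mdistxx.
    by have [w [? ? ?]] := perf z r Az r0; exists w; rewrite -zy.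
  have wy0 : 0 < mdist w y by rewrite mdist_gt0.
  (* The first bound keeps the closed ball inside the old one, the second leaves [y] outside. *)
  exists (w, Num.min (r - mdist z w) (mdist w y / 2)) => _; split => //=.
    by rewrite lt_min subr_gt0 zw divr_gt0.
  move=> x; rewrite le_min => /andP[xr xy]; split.
    have := metric_triangle z w x; lra.
  move=> fx; have xyE : x = y by apply: finj; rewrite ?inE// fx fy.
  by move: xy; rewrite xyE; lra.
have [g gP] := choice shrink.
pose s := fix s n := if n is m.+1 then g (m, s m) else (a, 1 : R).
have sP n : A (s n).1 /\ 0 < (s n).2.
  by elim: n => [|n /(gP (n, s n))[]]//=.
pose C n := [set x | mdist (s n).1 x <= (s n).2].
have Csub n m : (n <= m)%N -> C m `<=` C n.
  move=> /subnK <-; elim: (m - n)%N => [//|k IH] x Cx; apply: IH.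
  by have [_ _ /(_ x Cx)[]] := gP ((k + n)%N, s (k + n)%N) (sP _).
have [p [_ clp]] := @compact_setT R X ((fun n => (s n).1) @ \oo) _ filterT.
have Cp n : C n p.
  have clC : closed (C n).
    rewrite (_ : C n = mdist (s n).1 @^-1` [set t | t <= (s n).2])//.
    apply: preimage_closed => [x _|]; last exact: closed_le.
    apply: (@continuous_mdist _ _ _ (fun=> (s n).1) id) => y.
      exact: cvg_cst.
    exact: cvg_id.
  apply: clC => U nU; have := clp (C n) U _ nU; apply.
  exists n => // m /= nm; apply: (Csub _ _ nm).
  by rewrite /C /= mdistxx ltW//; have [] := sP m.
(* The ball of index [(f p).+1] was built to omit the point numbered [f p], which is [p]. *)
by have [_ _ /(_ p (Cp (f p).+1))[_]] := gP (f p, s (f p)) (sP (f p)).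
Qed.

(** * Integer iterates, orbits, and periodicity of recurrent points *)

Section iterates.
Context {X : topologicalType}.
Implicit Type T : homeo X.

Lemma iter_continuous (f : X -> X) n : continuous f -> continuous (iter n f).
Proof.
move=> cf; elim: n => [|n IH] x; first exact: cvg_id.
by apply: (@continuous_comp _ _ _ (iter n f) f); [exact: IH|exact: cf].
Qed.

Lemma iter_cancel (f g : X -> X) n : cancel f g -> cancel (iter n f) (iter n g).
Proof.
by move=> fK; elim: n => [//|n IH] x; rewrite iterSr iterS fK IH.
Qed.

Lemma iter_invK T j n x : (j <= n)%N ->
  iter j (homeo_inv T) (iter n T x) = iter (n - j) T x.
Proof.
move=> jn; rewrite -[in LHS](subnKC jn) iterD.
exact: iter_cancel (@homeo_funK _ T) _.
Qed.

Lemma iter_inv_fix T n x : iter n T x = x -> iter n (homeo_inv T) x = x.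
Proof. by move=> Tx; rewrite -[in LHS]Tx iter_cancel//; exact: homeo_funK. Qed.

Lemma iter_dvd_fix (f : X -> X) p n x :
  iter p f x = x -> (p %| n)%N -> iter n f x = x.
Proof.
by move=> fx /dvdnP[k ->]; rewrite iterM iter_fix.
Qed.

Lemma iterz_fix_periodic T n x : n != 0 -> iterz T n x = x ->
  exists2 k, (0 < k)%N & iter k T x = x.
Proof.
case: n => [[//|n]|n] _ /= Tx; first by exists n.+1.
exists n.+1 => //; rewrite -[in LHS]Tx.
exact: (@iter_cancel _ _ n.+1 (@homeo_invK _ T)).
Qed.

(** The two-sided orbit, since recurrence may occur along negative times; the natural exponents [a]
    and [b] encode [T^(a-b)]. *)
Definition homeo_orbit T x :=
  [set y | exists a b, y = iter a T (iter b (homeo_inv T) x)].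

Lemma iterz_orbit T n x y : homeo_orbit T x y -> homeo_orbit T x (iterz T n y).
Proof.
case: n => n [a [b ->]] /=; first by exists (n + a)%N, b; rewrite iterD.
exists a, (n.+1 + b)%N; rewrite iterD -iterS.
have comm z : homeo_inv T (iter a T z) = iter a T (homeo_inv T z).
  by case: a => [//|a]; rewrite iterS iterSr homeo_funK homeo_invK.
by elim: n.+1 (iter b _ x) => [//|k IH] z; rewrite !iterS IH comm.
Qed.

End iterates.

(** An isolated point of the orbit is [f x] for a power [f] of [T]. The points [f (iterz T (n i) x)]
    stay in the orbit and tend to [f x], so they eventually equal it, and [f] is injective. *)
Lemma recurrent_periodic (R : realType) (X : compactMetricType R) (T : homeo X)
    x : countable [set: X] -> recurrent T x ->
  exists2 n, (0 < n)%N & iter n T x = x.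
Proof.
move=> cX [n [ninf nx]].
have [|_ [[a [b ->]] [e e0 iso]]] :=
  @countable_compact_isolated _ _ (homeo_orbit T x) cX.
  by exists x, 0%N, 0%N.
pose f := fun y => iter a T (iter b (homeo_inv T) y).
have fcont : continuous f.
  move=> y; apply: continuous_comp; apply: iter_continuous.
    exact: homeo_inv_continuous.
  exact: homeo_continuous.
have f_inj : injective f.
  by move=> y z /(can_inj (iter_cancel _ (@homeo_funK _ T)))
     /(can_inj (iter_cancel _ (@homeo_invK _ T))).
have forbit y : homeo_orbit T x y -> homeo_orbit T x (f y).
  move=> xy; have /(@iterz_orbit _ _ (Posz a)) :
      homeo_orbit T x (iter b (homeo_inv T) y).
    (* [Negz b] is the exponent [-(b+1)], so exponent zero is treated apart. *)
    case: b @f {iso fcont f_inj} => [//|b] _.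
    exact: (@iterz_orbit _ _ (Negz b)).
  by [].
have fnx : f (iterz T (n i) x) @[i --> \oo] --> f x.
  exact: (continuous_cvg _ (fcont x) nx).
have near_fix : \forall i \near \oo, iterz T (n i) x = x.
  have : \forall i \near \oo, mdist (f x) (f (iterz T (n i) x)) < e.
    exact: metricType_numDomainType.cvgr_dist_lt.
  apply: filterS => i fi; apply: f_inj; apply: iso fi.
  by apply/forbit/iterz_orbit; exists 0%N, 0%N.
have [i [nix ni0]] : exists i, iterz T (n i) x = x /\ n i != 0.
  case: ninf => ninf.
    have [i [? ?]] := filter_ex (filterI near_fix (ninf 1)).
    by exists i; split => //; rewrite gt_eqF.
  have [i [? ni]] := filter_ex (filterI near_fix (ninf (-1))).
  by exists i; split => //; rewrite lt_eqF// (le_lt_trans ni).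
exact: iterz_fix_periodic ni0 nix.
Qed.

(** * Equicontinuity from pointwise periodicity *)

Section equicontinuity.
Context {R : realType} {X : compactMetricType R}.
Variable T : homeo X.
Hypothesis perT : pointwise_periodic T.

Lemma common_period x y :
  exists2 n, (0 < n)%N & iter n T x = x /\ iter n T y = y.
Proof.
have [p p0 px] := perT x; have [q q0 qy] := perT y.
exists (p * q)%N; first by rewrite muln_gt0 p0.
by split; [apply: iter_dvd_fix px _; exact: dvdn_mulr
          |apply: iter_dvd_fix qy _; exact: dvdn_mull].
Qed.

(** For a pair at distance more than [r], a common period is a valid time [j], and by continuity it
    is valid for all nearby pairs. Near a pair at distance less than [r] the premise fails.
    Compactness of [X * X] then bounds the times. *)
Lemma backward_return (r : R) : (forall x y : X, mdist x y != r) ->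
  exists N, forall x y : X, r < mdist x y -> exists2 j, (0 < j <= N)%N &
    r < mdist (iter j (homeo_inv T) x) (iter j (homeo_inv T) y).
Proof.
move=> avoid.
have cfar j : continuous (fun p : X * X =>
    mdist (iter j (homeo_inv T) p.1) (iter j (homeo_inv T) p.2) : R).
  by apply: continuous_mdist => p; apply: continuous_comp;
    [exact: cvg_fst|apply: iter_continuous; exact: homeo_inv_continuous
    |exact: cvg_snd|apply: iter_continuous; exact: homeo_inv_continuous].
have /compact_near_coveringP :=
  compact_setX (@compact_setT R X) (@compact_setT R X).
move=> /(_ nat \oo (fun N p => r < mdist p.1 p.2 -> exists2 j, (0 < j <= N)%N &
    r < mdist (iter j (homeo_inv T) p.1) (iter j (homeo_inv T) p.2)) _)[|N _ H].
  move=> [x y] _; have [xy|xy] := ltP r (mdist x y); last first.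
    have xyr : mdist x y < r by rewrite lt_neqAle avoid.
    exists ([set p | mdist p.1 p.2 < r], setT) => /=.
      by split; [exact: (cvgr_lt _ (cfar 0%N (x, y)))|exact: filterT].
    by move=> [p N] /= [pr _]; rewrite ltNge ltW.
  have [p p0 [px py]] := common_period x y.
  exists ([set q | r < mdist (iter p (homeo_inv T) q.1)
      (iter p (homeo_inv T) q.2)], [set N | (p <= N)%N]) => /=.
    split; last exact: nbhs_infty_ge.
    by apply: (cvgr_gt _ (cfar p (x, y))); rewrite /= !iter_inv_fix.
  by move=> [q N] /= [qr pN] _; exists p; rewrite // p0.
exists N => x y xy; exact: (H N (leqnn N) (x, y)).
Qed.

(** Continuity handles the times [0] to [N]. If the distance exceeded [r] at a later time [n], it
    would do so at some time [n - j] with [0 < j <= N], against strong induction. *)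
Lemma equicontinuous_periodic (r : R) : 0 < r ->
  (forall x y : X, mdist x y != r) ->
  forall x : X, \forall y \near x, forall n,
    mdist (iter n T x) (iter n T y) < r.
Proof.
move=> r0 avoid x; have [N HN] := backward_return avoid.
have : \forall y \near x, forall j : 'I_N.+1,
    mdist (iter j T x) (iter j T y) < r.
  apply: filter_forall => j.
  apply: (metricType_numDomainType.cvgr_dist_lt _ r0).
  exact: iter_continuous (@homeo_continuous _ T) x.
apply: filterS => y xyN; elim/ltn_ind => n IH.
have [nN|Nn] := ltnP n N.+1; first exact: (xyN (Ordinal nN)).
rewrite lt_neqAle avoid leNgt; apply/negP => /HN[j /andP[j0 jN]].
have jn : (j <= n)%N by rewrite (leq_trans jN)// ltnW.
rewrite !iter_invK// ltNge ltW// IH// ltn_subrL j0 /=.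
exact: leq_trans jn.
Qed.

(** Once [n] is at least a period of [x], that period divides [n!], so the iterate fixes [x];
    equicontinuity controls the points near [x]. *)
Lemma iter_fact_cvg_id : countable [set: X] -> forall e : R, 0 < e ->
  \forall n \near \oo, forall x, mdist x (iter n`! T x) < e.
Proof.
move=> cX e e0; have e20 : 0 < e / 2 by rewrite divr_gt0.
have [r [r0 re avoid]] := countable_avoid_dist cX e20.
have /compact_near_coveringP := @compact_setT R X.
move=> /(_ nat \oo (fun n x => mdist x (iter n`! T x) < e) _)[x _|]; last first.
  by move=> N _ H; exists N => // n /= Nn x; exact: (H n Nn x).
have [p p0 px] := perT x.
exists ([set y | forall n, mdist (iter n T x) (iter n T y) < r],
        [set N | (p <= N)%N]) => /=.
  by split; [exact: equicontinuous_periodic|exact: nbhs_infty_ge].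
move=> [y n] /= [xy pn].
have fx : iter n`! T x = x by apply: iter_dvd_fix px _; rewrite dvdn_fact// p0.
(* Time [0] bounds the distance from [y] to [x], time [n!] that from [x] to the iterate of [y]; the
   sum is below [2 r < e]. *)
have := xy 0%N; have := xy n`!; rewrite fx /=.
have := metric_triangle y x (iter n`! T y); rewrite (metric_sym y x); lra.
Qed.

End equicontinuity.

Lemma cvg_fact_infty : n`! @[n --> \oo] --> \oo.
Proof.
apply/cvgnyPge => N; near=> n; apply: leq_trans (fact_geq n).
by near: n; exact: nbhs_infty_ge.
Unshelve. all: by end_near. Qed.

(** * Iterates on the hyperspace *)

Section hyperspace_iterates.
Context {R : realType} {X : compactMetricType R}.
Implicit Types (T : homeo X) (A : hyperspace X).

Lemma iter_hyper_homeo T n A : hset (iter n (hyper_homeo T) A) = iter n T @` A.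
Proof.
elim: n => [|n IH]; first by rewrite image_id.
by rewrite iterS /= IH image_comp.
Qed.

Lemma iterz_hyper_homeo T n A :
  hset (iterz (hyper_homeo T) n A) = iterz T n @` A.
Proof.
case: n => n; first exact: iter_hyper_homeo.
exact: (iter_hyper_homeo (homeo_sym T) n.+1).
Qed.

Lemma mdist_hyper_iter_le T n A (e : R) :
  (forall x, mdist x (iter n T x) <= e) ->
  mdist A (iter n (hyper_homeo T) A) <= e.
Proof.
move=> Te; rewrite hyperspace_mdistE; apply: hausdorff_dist_le.
  by move=> x Ax; exists (iter n T x); rewrite ?iter_hyper_homeo//; exists x.
move=> y; rewrite iter_hyper_homeo => -[x Ax <-]; exists x => //.
by rewrite metric_sym.
Qed.

(** Singletons embed [X] in its hyperspace, which brings recurrence down to [X]. *)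
Definition hyper_set1 (x : X) : hyperspace X :=
  Hyperspace (@accessible_closed_set1 X
    (hausdorff_accessible (@metric_hausdorff R X)) x)
    (ex_intro _ x erefl).

Lemma recurrent_hyper_set1 T x :
  recurrent (hyper_homeo T) (hyper_set1 x) -> recurrent T x.
Proof.
move=> [n [ninf nx]]; exists n; split => //.
apply/metricType_numDomainType.cvgrPdist_lt => e e0.
have : \forall i \near \oo, mdist (hyper_set1 x)
    (iterz (hyper_homeo T) (n i) (hyper_set1 x)) < e.
  exact: metricType_numDomainType.cvgr_dist_lt.
apply: filterS => i /hausdorff_dist_lt[/(_ x erefl)[y + xy] _].
by rewrite iterz_hyper_homeo => -[z -> ->].
Qed.

End hyperspace_iterates.

(** * Implications between rigidity and recurrence *)

Section rigidity.
Context {X : topologicalType}.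
Implicit Type T : homeo X.

Lemma iterz_prod_homeo T n k (x : {ptws 'I_n -> X}) i :
  iterz (prod_homeo T n) k x i = iterz T k (x i).
Proof.
case: k => k /=; first by elim: k => [//|k IH]; rewrite !iterS -IH.
by congr homeo_inv; elim: k => [//|k IH]; rewrite !iterS -IH.
Qed.

Lemma tends_to_pinfty_Posz (m : nat -> nat) :
  m i @[i --> \oo] --> \oo -> tends_to_pinfty (fun i => Posz (m i)).
Proof.
move=> /cvgnyPge moo [N|N]; last by exists 0%N.
by apply: filterS (moo N) => i; rewrite lez_nat.
Qed.

(** Convergence in the product is coordinatewise, so the one sequence [m] serves every power. *)
Lemma rigid_weakly_rigid T : rigid T -> weakly_rigid T.
Proof.
move=> [m [_ moo mT]] n _ x; exists (fun i => Posz (m i)); split.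
  by left; exact: tends_to_pinfty_Posz.
apply/cvg_sup => i U [V] [[W oW <-] Wx WU].
have /mT : nbhs (x i) W by exact: open_nbhs_nbhs.
rewrite nbhs_simpl /=; apply: filterS => k Wk; apply: WU.
by have := iterz_prod_homeo T (Posz (m k)) x i => /= ->.
Qed.

Lemma weakly_rigid_pointwise_recurrent T :
  weakly_rigid T -> pointwise_recurrent T.
Proof.
move=> wT x; have [n [ninf nx]] := wT 1%N isT (fun=> x).
exists n; split => //.
move=> U /= Ux.
have := @proj_continuous _ (fun=> X) (ord0 : 'I_1) (fun=> x) _ Ux.
move=> /nx; rewrite !nbhs_simpl /=; apply: filterS => i.
by rewrite /proj /= iterz_prod_homeo.
Qed.

End rigidity.

Section uniform_rigidity.
Context {R : realType} {X : metricType R}.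
Implicit Type T : homeo X.

Lemma uniformly_rigid_rigid T : uniformly_rigid T -> rigid T.
Proof.
move=> [m [m0 moo /uniform_cvg_idP mT]]; exists m; split => // x.
apply/metricType_numDomainType.cvgrPdist_lt => e e0.
by apply: filterS (mT e e0) => i; exact.
Qed.

(** Stated for metric spaces so as to serve both [X] and its hyperspace. *)
Lemma fact_uniformly_rigid T :
  (forall e : R, 0 < e ->
    \forall n \near \oo, forall x, mdist x (iter n`! T x) < e) ->
  uniformly_rigid T.
Proof.
move=> Tid; exists (fun n => n`!); split => //.
- by move=> n; exact: fact_gt0.
- exact: cvg_fact_infty.
- exact/uniform_cvg_idP.
Qed.

End uniform_rigidity.

(** * Implications resting on countability *)

Section countable.
Context {R : realType} {X : compactMetricType R} (T : homeo X).
Hypothesis X_countable : countable [set: X].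

Lemma pointwise_periodic_uniformly_rigid :
  pointwise_periodic T -> uniformly_rigid T.
Proof.
by move=> perT; apply: fact_uniformly_rigid; exact: iter_fact_cvg_id.
Qed.

Lemma pointwise_periodic_hyper_uniformly_rigid :
  pointwise_periodic T -> uniformly_rigid (hyper_homeo T).
Proof.
move=> perT; apply: fact_uniformly_rigid => e e0.
(* Halving [e] restores strictness, as the bound on the Hausdorff distance is non-strict. *)
have e20 : 0 < e / 2 by rewrite divr_gt0.
apply: filterS (iter_fact_cvg_id perT X_countable e20) => n Tn A.
apply: (@le_lt_trans _ _ (e / 2)); last by lra.
by apply: mdist_hyper_iter_le => x; exact/ltW/Tn.
Qed.

Lemma hyper_recurrent_pointwise_periodic :
  pointwise_recurrent (hyper_homeo T) -> pointwise_periodic T.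
Proof.
by move=> recT x; apply: recurrent_periodic => //; exact: recurrent_hyper_set1.
Qed.

Lemma uniformly_rigid_pointwise_periodic :
  uniformly_rigid T -> pointwise_periodic T.
Proof.
move=> /uniformly_rigid_rigid/rigid_weakly_rigid.
move=> /weakly_rigid_pointwise_recurrent recT x.
exact: recurrent_periodic.
Qed.

End countable.

Theorem theorem5p13 (R : realType) (X : compactMetricType R) (T : homeo X)
    (X_countable : countable [set: X]) :
  [<-> pointwise_recurrent (hyper_homeo T);
       uniformly_rigid (hyper_homeo T);
       rigid (hyper_homeo T);
       weakly_rigid (hyper_homeo T);
       uniformly_rigid T;
       pointwise_periodic T].
Proof.
(* In the cycle of implications, those leaving the first and fourth statements pass through
   periodicity of [T]. *)
tfae.
- move=> /(hyper_recurrent_pointwise_periodic X_countable).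
  exact: pointwise_periodic_hyper_uniformly_rigid.
- exact: uniformly_rigid_rigid.
- exact: rigid_weakly_rigid.
- move=> /weakly_rigid_pointwise_recurrent.
  move=> /(hyper_recurrent_pointwise_periodic X_countable).
  exact: pointwise_periodic_uniformly_rigid.
- exact: uniformly_rigid_pointwise_periodic.
- move=> /(pointwise_periodic_hyper_uniformly_rigid X_countable).
  move=> /uniformly_rigid_rigid/rigid_weakly_rigid.
  exact: weakly_rigid_pointwise_recurrent.
Qed.
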